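(* Let $(X,d)$ be a compact extended Ptolemy metric space such that any three points of $X$ lie on a circle in $X$. Then through any three distinct points of $X$ there exists a unique circle in $X$.
   Context: An extended metric on a set $X$ (with at least two points) is a map $d:X\times X\to[0,\infty]$ such that for some subset $\Omega(d)$ with at most one element, $d$ is a finite metric on $X\setminus\Omega(d)$, $d(x,\omega)=\infty$ for $x\notin\Omega(d)$, $\omega\in\Omega(d)$, and $d(\omega,\omega)=0$ (the point $\omega$ is written $\infty$). The topology has basis the open balls around points of $X\setminus\Omega(d)$ and the complements of closed balls; compactness refers to this topology. In product-of-distances expressions in which a single point equals $\infty$, factors involving $\infty$ are cancelled. $(X,d)$ is Ptolemy if $d(x,y)d(z,w)\le d(x,z)d(y,w)+d(x,w)d(y,z)$ for all quadruples. A circle in $X$ is a subset $\sigma$ homeomorphic to $S^1$ such that for all distinct $x,y,z,w\in\sigma$ with $y,w$ in different components of $\sigma\setminus\{x,z\}$, $d(x,z)d(y,w)=d(x,y)d(z,w)+d(x,w)d(y,z)$. *)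

(* Defs.v *)
From Stdlib Require Import Reals List.
From Coquelicot Require Import Rbar.
Open Scope R_scope.

Section ExtMetric.
Context {X : Type}.

Record ext_metric (d : X -> X -> Rbar) (Om : X -> Prop) : Prop := {
  em_two : exists a b : X, a <> b;
  em_Om_sub : forall a b, Om a -> Om b -> a = b;
  em_fin : forall x y, ~ Om x -> ~ Om y -> exists r, d x y = Finite r /\ 0 <= r;
  em_zero : forall x y, ~ Om x -> ~ Om y -> (d x y = Finite 0 <-> x = y);
  em_sym : forall x y, ~ Om x -> ~ Om y -> d x y = d y x;
  em_tri : forall x y z, ~ Om x -> ~ Om y -> ~ Om z ->
     Rbar_le (d x z) (Rbar_plus (d x y) (d y z));
  em_inf : forall x w, ~ Om x -> Om w -> d x w = p_infty /\ d w x = p_infty;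
  em_diag : forall w, Om w -> d w w = Finite 0 }.

Definition ball (d : X -> X -> Rbar) (x : X) (r : R) : X -> Prop :=
  fun y => Rbar_lt (d x y) (Finite r).
Definition coball (d : X -> X -> Rbar) (x : X) (r : R) : X -> Prop :=
  fun y => Rbar_lt (Finite r) (d x y).

Definition ext_open (d : X -> X -> Rbar) (Om : X -> Prop) (U : X -> Prop) : Prop :=
  forall p, U p -> exists x r, ~ Om x /\ 0 < r /\
    ((ball d x r p /\ forall y, ball d x r y -> U y) \/
     (coball d x r p /\ forall y, coball d x r y -> U y)).

Definition ext_compact (d : X -> X -> Rbar) (Om : X -> Prop) : Prop :=
  forall (I : Type) (U : I -> X -> Prop),
    (forall i, ext_open d Om (U i)) -> (forall x, exists i, U i x) ->
    exists l : list I, forall x, exists i, In i l /\ U i x.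

(** Distance factor with the cancellation convention: factors involving the
    infinite point are replaced by 1 (i.e. cancelled). Only used on quadruples
    in which at most one point is infinite. *)
Definition dfac (d : X -> X -> Rbar) (a b : X) : R :=
  match d a b with Finite r => r | _ => 1 end.

Definition atmost1 (Om : X -> Prop) (x y z w : X) : Prop :=
  ~ (Om x /\ Om y) /\ ~ (Om x /\ Om z) /\ ~ (Om x /\ Om w) /\
  ~ (Om y /\ Om z) /\ ~ (Om y /\ Om w) /\ ~ (Om z /\ Om w).

Definition ptolemy (d : X -> X -> Rbar) (Om : X -> Prop) : Prop :=
  forall x y z w, atmost1 Om x y z w ->
    dfac d x y * dfac d z w <= dfac d x z * dfac d y w + dfac d x w * dfac d y z.

Definition ext_connected (d : X -> X -> Rbar) (Om : X -> Prop) (A : X -> Prop) : Prop :=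
  forall U V, ext_open d Om U -> ext_open d Om V ->
    (forall a, A a -> U a \/ V a) -> (forall a, A a -> U a -> V a -> False) ->
    (exists a, A a /\ U a) -> (exists a, A a /\ V a) -> False.

Definition same_component (d : X -> X -> Rbar) (Om : X -> Prop) (S : X -> Prop) (y w : X) : Prop :=
  exists C : X -> Prop, (forall a, C a -> S a) /\ ext_connected d Om C /\ C y /\ C w.

End ExtMetric.

Definition S1 (p : R * R) : Prop := fst p ^ 2 + snd p ^ 2 = 1.
Definition eopen (U : R * R -> Prop) : Prop :=
  forall p, U p -> exists e, 0 < e /\
    forall q, (fst q - fst p) ^ 2 + (snd q - snd p) ^ 2 < e ^ 2 -> U q.

Definition homeo_S1 {X : Type} (d : X -> X -> Rbar) (Om : X -> Prop) (s : X -> Prop) : Prop :=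
  exists (f : R * R -> X) (g : X -> R * R),
    (forall p, S1 p -> s (f p)) /\ (forall x, s x -> S1 (g x)) /\
    (forall p, S1 p -> g (f p) = p) /\ (forall x, s x -> f (g x) = x) /\
    (forall V, ext_open d Om V -> exists U, eopen U /\ forall p, S1 p -> (V (f p) <-> U p)) /\
    (forall U, eopen U -> exists V, ext_open d Om V /\ forall x, s x -> (U (g x) <-> V x)).

Definition is_circle {X : Type} (d : X -> X -> Rbar) (Om : X -> Prop) (s : X -> Prop) : Prop :=
  homeo_S1 d Om s /\
  forall x y z w, s x -> s y -> s z -> s w ->
    x <> y -> x <> z -> x <> w -> y <> z -> y <> w -> z <> w ->
    ~ same_component d Om (fun a => s a /\ a <> x /\ a <> z) y w ->
    dfac d x z * dfac d y w = dfac d x y * dfac d z w + dfac d x w * dfac d y z.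

(* Main.v *)
Require Import Defs.
From Stdlib Require Import Reals Ranalysis5 Lra Psatz List Lia Classical ClassicalEpsilon.
From Coquelicot Require Import Rcomplements Rbar.

(** Send a point [o] of [X] to infinity: [D(u,v) = d(u,v) / (d(u,o) d(v,o))] is a
    Ptolemaic metric on [X \ {o}], in which an arc of a circle through [o] is a
    geodesic; so any two points have a midpoint, and it suffices to prove that
    geodesics are unique (three distinct points cut a circle into three arcs; send
    to infinity the point not on the arc considered).
    Let [w], [v] be two geodesics from [x] to [y] with [w(t0) <> v(t0)], and let
    [p(t)] be a midpoint of [w(t)] and [v(t)]. Ptolemy's inequality forces
    [p(t)] to lie at distance [t] from [x] and [L - t] from [y]. For [s < s'],
    Ptolemy's inequality applied to [x, p(s'), w(s), v(s)] and to
    [y, p(s), w(s'), v(s')] says that the distances from [w], [v] at one level to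
    [p] at the other level exceed the half-gap by an amount of order [s' - s]; applied
    to [w(s), p(s'), p(s), w(s')] and to the same points with [v] for [w], it bounds
    this excess by [(s' - s) D(p(s), p(s'))]. Hence the points [p(t)], for [t]
    near [t0], are uniformly separated, against compactness. *)

(** * Inversion *)

(* No triangle inequality: with the cancellation convention [dfac d] violates it
   at the infinite point. *)
Record ptolemaic {X : Type} (P : X -> Prop) (D : X -> X -> R) : Prop := {
  pt_ge0 : forall x y, P x -> P y -> 0 <= D x y;
  pt_eq0 : forall x y, P x -> P y -> (D x y = 0 <-> x = y);
  pt_sym : forall x y, P x -> P y -> D x y = D y x;
  pt_ptolemy : forall x y z w, P x -> P y -> P z -> P w ->
    D x y * D z w <= D x z * D y w + D x w * D y z }.

Definition inversion {X : Type} (q : X -> X -> R) (o x y : X) : R :=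
  q x y / (q x o * q y o).

Section Inversion.
Context {X : Type} (q : X -> X -> R) (Q : ptolemaic (fun _ => True) q) (o : X).

Lemma semimetric_pos (x y : X) : x <> y -> 0 < q x y.
Proof.
intros n; destruct (Rle_lt_or_eq_dec 0 (q x y)) as [h|h]; [now apply Q|easy|].
exfalso; apply n, Q; auto.
Qed.

(** Each product in Ptolemy's inequality contains each of the four points exactly once, so the
    denominators of [inversion] scale all three products by one common factor. *)
Lemma inversion_ptolemaic : ptolemaic (fun x => x <> o) (inversion q o).
Proof.
assert (pos := fun x (h : x <> o) => semimetric_pos x o h).
split; unfold inversion.
- intros x y hx hy; apply Rdiv_le_0_compat; [now apply Q|].
  apply Rmult_lt_0_compat; auto.
- intros x y hx hy; rewrite <- (pt_eq0 _ _ Q x y I I).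
  specialize (pos x hx) as px; specialize (pos y hy) as py; split; intros h.
  + apply (Rmult_eq_reg_r (/ (q x o * q y o))); [unfold Rdiv in h; lra|].
    apply Rinv_neq_0_compat; nra.
  + rewrite h; unfold Rdiv; ring.
- intros x y hx hy; rewrite (pt_sym _ _ Q x y I I), (Rmult_comm (q x o)); easy.
- intros x y z w hx hy hz hw.
  specialize (pos x hx) as px; specialize (pos y hy) as py.
  specialize (pos z hz) as pz; specialize (pos w hw) as pw.
  apply (Rmult_le_reg_r (q x o * q y o * q z o * q w o)).
  { repeat apply Rmult_lt_0_compat; easy. }
  pose proof (pt_ptolemy _ _ Q x y z w I I I I) as H.
  match goal with |- ?l <= ?r => replace l with (q x y * q z w) by (field; lra);
    replace r with (q x z * q y w + q x w * q y z) by (field; lra) end.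
  easy.
Qed.

(** Ptolemy's inequality for [x], [y], [z], [o], divided by the product of the three distances to
    [o]. *)
Lemma inversion_triangle (x y z : X) : x <> o -> y <> o -> z <> o ->
  inversion q o x z <= inversion q o x y + inversion q o y z.
Proof.
intros hx hy hz; unfold inversion.
pose proof (semimetric_pos x o hx) as px; pose proof (semimetric_pos y o hy) as py.
pose proof (semimetric_pos z o hz) as pz.
apply (Rmult_le_reg_r (q x o * q y o * q z o)).
{ repeat apply Rmult_lt_0_compat; easy. }
pose proof (pt_ptolemy _ _ Q x z y o I I I I) as H.
rewrite (pt_sym _ _ Q z y I I) in H.
match goal with |- ?l <= ?r => replace l with (q x z * q y o) by (field; lra);
  replace r with (q x y * q z o + q x o * q y z) by (field; lra) end.
easy.
Qed.

(* The four-point Ptolemy equality becomes additivity of distances once one of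
   the four points is sent to infinity. *)
Lemma inversion_additive (x y z : X) : x <> o -> y <> o -> z <> o ->
  (q x z * q y o = q x y * q z o + q x o * q y z <->
   inversion q o x z = inversion q o x y + inversion q o y z).
Proof.
intros hx hy hz; unfold inversion.
pose proof (semimetric_pos x o hx) as px; pose proof (semimetric_pos y o hy) as py.
pose proof (semimetric_pos z o hz) as pz.
assert (p : q x o * q y o * q z o <> 0).
{ apply Rgt_not_eq; repeat apply Rmult_lt_0_compat; easy. }
assert (e1 : q x z / (q x o * q z o) * (q x o * q y o * q z o) = q x z * q y o)
  by (field; lra).
assert (e2 : (q x y / (q x o * q y o) + q y z / (q y o * q z o)) * (q x o * q y o * q z o)
  = q x y * q z o + q x o * q y z) by (field; lra).
rewrite <- e1, <- e2; split; intros h; [now apply Rmult_eq_reg_r in h|now rewrite h].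
Qed.
End Inversion.

(** * Uniqueness of geodesics *)

(** In the application, [A], [C] are the distances from [w(s)], [v(s)] to [p(s')], [B], [D] those
    from [p(s)] to [w(s')], [v(s')], [h], [h'] the half-gaps at the two levels, and [e] the distance
    from [p(s)] to [p(s')]. The proof bounds a weighted sum of the excesses over the half-gaps from
    both sides and divides by [2 (s' - s)]. *)
Lemma geodesic_strip_estimate (L s s' h h' h0 A B C D e : R) :
  0 < s -> s < s' -> s' < L -> 0 < h0 -> h0 <= h -> h0 <= h' ->
  2 * h * s' <= s * (A + C) -> 2 * h' * (L - s) <= (L - s') * (B + D) ->
  A * B <= (s' - s) * e + h * h' -> C * D <= (s' - s) * e + h * h' ->
  Rabs (A - h') <= s' - s -> Rabs (C - h') <= s' - s ->
  Rabs (B - h) <= s' - s -> Rabs (D - h) <= s' - s ->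
  2 * h0 ^ 2 <= L * (e + (s' - s)).
Proof.
intros s0 ss sL h00 hh hh' H1 H2 H3 H4 A1 C1 B1 D1.
apply Rabs_le_between in A1, B1, C1, D1.
set (t := s' - s) in *; assert (t0 : 0 < t) by (unfold t; lra).
set (a := A - h') in *; set (c := C - h') in *; set (b := B - h) in *; set (d := D - h) in *.
replace A with (h' + a) in * by (unfold a; ring); replace C with (h' + c) in * by (unfold c; ring).
replace B with (h + b) in * by (unfold b; ring); replace D with (h + d) in * by (unfold d; ring).
clearbody a b c d.
(* Substituting [s' = s + t] gives this bound with [s] in place of [L]; the bracket is then
   nonnegative, so [s] may be enlarged. *)
assert (k1 : 2 * h * t <= L * (a + c + 2 * (h' - h))).
{ assert (2 * h * t <= s * (a + c + 2 * (h' - h))) by (unfold t; nra).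
  assert (0 <= a + c + 2 * (h' - h)) by nra. nra. }
assert (k2 : 2 * h' * t <= L * (b + d + 2 * (h - h'))).
{ assert (2 * h' * t <= (L - s') * (b + d + 2 * (h - h'))) by (unfold t; nra).
  assert (0 <= b + d + 2 * (h - h')) by nra. nra. }
assert (ab : - t ^ 2 <= a * b) by nra.
assert (cd : - t ^ 2 <= c * d) by nra.
assert (k3 : h * (a + c) + h' * (b + d) <= 2 * t * e + 2 * t ^ 2) by nra.
(* Add [h] times [k1] and [h'] times [k2]: the terms in [h' - h] collapse to a nonpositive
   square. *)
assert (k4 : 2 * (h ^ 2 + h' ^ 2) * t <=
  L * (h * (a + c) + h' * (b + d)) - 2 * L * (h - h') ^ 2) by nra.
assert (k5 : 4 * h0 ^ 2 * t <= 2 * (h ^ 2 + h' ^ 2) * t).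
{ apply Rmult_le_compat_r; [lra|]. nra. }
assert (0 <= (h - h') ^ 2) by apply pow2_ge_0.
apply (Rmult_le_reg_r (2 * t)); [lra|]. nra.
Qed.

(** Apply Ptolemy to [x], [p], [w], [v], with [D x p] multiplying the gap [2 h]: the right-hand side
    is [2 h t]. *)
Lemma midpoint_level {X : Type} (P : X -> Prop) (D : X -> X -> R) (x w v p : X) (t h : R) :
  ptolemaic P D -> P x -> P w -> P v -> P p -> D w v = 2 * h -> 0 < h ->
  D x w = t -> D x v = t -> D w p = h -> D p v = h -> D x p <= t.
Proof.
intros M Px Pw Pv Pp wv h0 xw xv wp pv.
pose proof (pt_ptolemy _ _ M x p w v Px Pp Pw Pv) as H.
rewrite (pt_sym _ _ M p w Pp Pw), wv, xw, xv, wp, pv in H.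
apply (Rmult_le_reg_r (2 * h)); lra.
Qed.

(** Compactness enters as [cpt]: a sequence in a ball around [x] has two terms as close as desired,
    which is what the separation of the midpoints contradicts. *)
Lemma geodesic_unique {X : Type} (P : X -> Prop) (D : X -> X -> R)
  (M : ptolemaic P D)
  (tri : forall a b c, P a -> P b -> P c -> D a c <= D a b + D b c)
  (mid : forall a b, P a -> P b -> a <> b ->
    exists p, P p /\ D a p = D a b / 2 /\ D p b = D a b / 2)
  (x y : X) (Px : P x) (Py : P y)
  (cpt : forall (p : nat -> X) (r e : R), 0 < e ->
    (forall n, P (p n) /\ D x (p n) <= r) ->
    exists n m, (n < m)%nat /\ D (p n) (p m) < e)
  (L : R) (xy : D x y = L) (w v : R -> X)
  (hw : forall t, 0 < t < L -> P (w t) /\ D x (w t) = t /\ D (w t) y = L - t)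
  (hv : forall t, 0 < t < L -> P (v t) /\ D x (v t) = t /\ D (v t) y = L - t)
  (dw : forall s t, 0 < s < L -> 0 < t < L -> D (w s) (w t) = Rabs (s - t))
  (dv : forall s t, 0 < s < L -> 0 < t < L -> D (v s) (v t) = Rabs (s - t)) :
  forall t, 0 < t < L -> w t = v t.
Proof.
intros t0 ht0; apply NNPP; intros neq.
set (H := D (w t0) (v t0)).
assert (H0 : 0 < H).
{ destruct (hw t0 ht0) as [Pw _], (hv t0 ht0) as [Pv _].
  destruct (Rle_lt_or_eq_dec 0 H) as [k|k]; [now apply M|easy|].
  exfalso; apply neq, (pt_eq0 _ _ M); auto. }
set (h0 := H / 4); assert (h00 : 0 < h0) by (unfold h0; lra).
set (g := h0 ^ 2 / L).
assert (g0 : 0 < g) by (apply Rdiv_lt_0_compat; nra).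
assert (hg : h0 ^ 2 = L * g) by (unfold g; field; lra).
(* All levels used lie in [(t0, t0 + k]]. The bound [H / 4] keeps the gap at least [H / 2], the
   bound [g] controls differences of levels, and the last bound keeps the levels below [L]. *)
set (k := Rmin (Rmin (H / 4) g) ((L - t0) / 2)).
assert (k0 : 0 < k) by (repeat apply Rmin_glb_lt; lra).
assert (k1 : k <= H / 4).
{ unfold k; eapply Rle_trans; [apply Rmin_l|apply Rmin_l]. }
assert (k2 : k <= g).
{ unfold k; eapply Rle_trans; [apply Rmin_l|apply Rmin_r]. }
assert (k3 : k <= (L - t0) / 2) by apply Rmin_r.
set (t := fun n => t0 + k / (INR n + 1)).
assert (tn : forall n, t0 < t n <= t0 + k).
{ intros n; unfold t; pose proof (pos_INR n).
  assert (0 < k / (INR n + 1)) by (apply Rdiv_lt_0_compat; lra).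
  assert (k / (INR n + 1) <= k); [|lra].
  apply Rle_div_l; nra. }
assert (tL : forall n, 0 < t n < L) by (intros n; specialize (tn n); lra).
assert (sep : forall n, 2 * h0 <= D (w (t n)) (v (t n))).
{ intros n; specialize (tn n).
  destruct (hw _ (tL n)) as [P1 _], (hv _ (tL n)) as [P2 _].
  destruct (hw _ ht0) as [P3 _], (hv _ ht0) as [P4 _].
  pose proof (tri _ _ _ P3 P1 P4) as T1; pose proof (tri _ _ _ P1 P2 P4) as T2.
  rewrite (dw _ _ ht0 (tL n)) in T1; rewrite (dv _ _ (tL n) ht0) in T2.
  rewrite Rabs_left1 in T1 by lra; rewrite Rabs_pos_eq in T2 by lra.
  fold H in T1; unfold h0; lra. }
set (h := fun n => D (w (t n)) (v (t n)) / 2).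
assert (ex : forall n, exists p, P p /\ D (w (t n)) p = h n /\ D p (v (t n)) = h n).
{ intros n; apply mid; [apply (hw _ (tL n))|apply (hv _ (tL n))|].
  intros e; specialize (sep n).
  rewrite (proj2 (pt_eq0 _ _ M _ _ (proj1 (hw _ (tL n))) (proj1 (hv _ (tL n)))) e) in sep.
  lra. }
set (p := fun n => proj1_sig (constructive_indefinite_description _ (ex n))).
assert (hp : forall n, P (p n) /\ D (w (t n)) (p n) = h n /\ D (p n) (v (t n)) = h n)
  by (intros n; exact (proj2_sig (constructive_indefinite_description _ (ex n)))).
clearbody p.
assert (hh : forall n, h0 <= h n /\ D (w (t n)) (v (t n)) = 2 * h n).
{ intros n; specialize (sep n); unfold h; lra. }
(* [midpoint_level] from both ends gives upper bounds with sum [L]; the triangle inequality through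
   [p n] turns both into equalities. *)
assert (lev : forall n, D x (p n) = t n /\ D y (p n) = L - t n).
{ intros n; destruct (hp n) as [Pp [wp pv]], (hh n) as [h1 h2].
  destruct (hw _ (tL n)) as [P1 [w1 w2]], (hv _ (tL n)) as [P2 [v1 v2]].
  rewrite (pt_sym _ _ M) in w2, v2 by easy.
  assert (D x (p n) <= t n)
    by (apply (midpoint_level P D x (w (t n)) (v (t n)) (p n) (t n) (h n)); auto; lra).
  assert (D y (p n) <= L - t n)
    by (apply (midpoint_level P D y (w (t n)) (v (t n)) (p n) (L - t n) (h n)); auto; lra).
  pose proof (tri x (p n) y Px Pp Py) as T; rewrite (pt_sym _ _ M (p n) y) in T by easy.
  lra. }
destruct (cpt p L g g0) as [n [m [nm close]]].
{ intros n; split; [apply hp|]; rewrite (proj1 (lev n)); specialize (tL n); lra. }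
(* The levels decrease to [t0], so the later index [m] has the lower level: [s = t m] and
   [s' = t n]. *)
assert (lt : t m < t n).
{ unfold t; apply Rplus_lt_compat_l, Rmult_lt_compat_l; [easy|].
  apply Rinv_lt_contravar; [|apply lt_INR in nm; lra].
  pose proof (pos_INR n); pose proof (pos_INR m); nra. }
pose proof (tn n) as tn1; pose proof (tn m) as tm1.
pose proof (tL n) as tn2; pose proof (tL m) as tm2.
destruct (hw _ tn2) as [Pw' [xw' wy']], (hv _ tn2) as [Pv' [xv' vy']].
destruct (hw _ tm2) as [Pw [xw wy]], (hv _ tm2) as [Pv [xv vy]].
destruct (hp n) as [Pp' [wp' pv']], (hp m) as [Pp [wp pv]].
destruct (hh n) as [h1' h2'], (hh m) as [h1 h2].
destruct (lev n) as [xp' yp'], (lev m) as [xp yp].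
pose proof (dw _ _ tm2 tn2) as ww; pose proof (dv _ _ tm2 tn2) as vv.
rewrite Rabs_left1 in ww, vv by lra.
rewrite (pt_sym _ _ M) in wy, wy', vy, vy', pv, pv', close by easy.
pose proof (fun a b Pa Pb => pt_sym _ _ M a b Pa Pb) as sym.
(* Both summands in the bracket are below [g], while [L g = h0 ^ 2]: a contradiction. *)
assert (2 * h0 ^ 2 <= L * (D (p m) (p n) + (t n - t m))); [|nra].
apply (geodesic_strip_estimate L (t m) (t n) (h m) (h n) h0
  (D (w (t m)) (p n)) (D (p m) (w (t n))) (D (v (t m)) (p n)) (D (p m) (v (t n))));
  try easy; try lra.
- pose proof (pt_ptolemy _ _ M x (p n) (w (t m)) (v (t m)) Px Pp' Pw Pv) as T.
  rewrite (sym (p n)), (sym (p n)) in T by easy. rewrite xw, xv, h2, xp' in T. lra.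
- pose proof (pt_ptolemy _ _ M y (p m) (w (t n)) (v (t n)) Py Pp Pw' Pv') as T.
  rewrite wy', vy', h2', yp in T. lra.
- pose proof (pt_ptolemy _ _ M _ _ _ _ Pw Pp' Pp Pw') as T.
  rewrite (sym (p n) (w (t n))), (sym (p n) (p m)), ww, wp, wp' in T by easy. lra.
- pose proof (pt_ptolemy _ _ M _ _ _ _ Pv Pp' Pp Pv') as T.
  rewrite (sym (p n) (v (t n))), (sym (p n) (p m)), vv, pv, pv' in T by easy. lra.
- pose proof (tri _ _ _ Pw Pw' Pp'); pose proof (tri _ _ _ Pw' Pw Pp').
  rewrite (sym (w (t n)) (w (t m))) in * by easy. apply Rabs_le_between; lra.
- pose proof (tri _ _ _ Pv Pv' Pp'); pose proof (tri _ _ _ Pv' Pv Pp').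
  rewrite (sym (v (t n)) (v (t m))) in * by easy. apply Rabs_le_between; lra.
- pose proof (tri _ _ _ Pp Pw Pw'); pose proof (tri _ _ _ Pp Pw' Pw).
  rewrite (sym (w (t n)) (w (t m))), (sym (p m) (w (t m))) in * by easy.
  apply Rabs_le_between; lra.
- pose proof (tri _ _ _ Pp Pv Pv'); pose proof (tri _ _ _ Pp Pv' Pv).
  rewrite (sym (v (t n)) (v (t m))), (sym (p m) (v (t m))) in * by easy.
  apply Rabs_le_between; lra.
Qed.

(** * The topology of an extended metric space *)

Section Ext.
Context {X : Type} (d : X -> X -> Rbar) (Om : X -> Prop).
Context (Hd : ext_metric d Om).

Lemma dfac_fin (x y : X) : ~ Om x -> ~ Om y -> d x y = Finite (dfac d x y).
Proof.
intros hx hy; destruct (em_fin _ _ Hd x y hx hy) as [r [e _]].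
unfold dfac; now rewrite e.
Qed.

Lemma dfac_inf_r (x y : X) : ~ Om x -> Om y -> dfac d x y = 1.
Proof.
intros hx hy; unfold dfac; now rewrite (proj1 (em_inf _ _ Hd x y hx hy)).
Qed.

Lemma dfac_inf_l (x y : X) : Om x -> ~ Om y -> dfac d x y = 1.
Proof.
intros hx hy; unfold dfac; now rewrite (proj2 (em_inf _ _ Hd y x hy hx)).
Qed.

Lemma dfac_inf_diag (x y : X) : Om x -> Om y -> x = y /\ dfac d x y = 0.
Proof.
intros hx hy; assert (e := em_Om_sub _ _ Hd x y hx hy); split; [easy|].
rewrite <- e; unfold dfac; now rewrite (em_diag _ _ Hd x hx).
Qed.

Lemma dfac_sym (x y : X) : dfac d x y = dfac d y x.
Proof.
destruct (classic (Om x)) as [hx|hx], (classic (Om y)) as [hy|hy].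
- now rewrite (em_Om_sub _ _ Hd x y hx hy).
- now rewrite (dfac_inf_l x y), (dfac_inf_r y x).
- now rewrite (dfac_inf_r x y), (dfac_inf_l y x).
- unfold dfac; now rewrite (em_sym _ _ Hd).
Qed.

Lemma dfac_eq0 (x y : X) : dfac d x y = 0 <-> x = y.
Proof.
destruct (classic (Om x)) as [hx|hx], (classic (Om y)) as [hy|hy].
- destruct (dfac_inf_diag x y hx hy); easy.
- rewrite dfac_inf_l by easy; split; [lra|intros <-; easy].
- rewrite dfac_inf_r by easy; split; [lra|intros <-; easy].
- rewrite <- (em_zero _ _ Hd x y hx hy), (dfac_fin x y hx hy); split; [intros ->; easy|].
  now intros [= ?].
Qed.

Lemma dfac_ge0 (x y : X) : 0 <= dfac d x y.
Proof.
destruct (classic (Om x)) as [hx|hx], (classic (Om y)) as [hy|hy].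
- rewrite (proj2 (dfac_inf_diag x y hx hy)); lra.
- rewrite dfac_inf_l by easy; lra.
- rewrite dfac_inf_r by easy; lra.
- destruct (em_fin _ _ Hd x y hx hy) as [r [e h]]; unfold dfac; now rewrite e.
Qed.

Lemma dfac_tri (x y z : X) : ~ Om x -> ~ Om y -> ~ Om z ->
  dfac d x z <= dfac d x y + dfac d y z.
Proof.
intros hx hy hz; pose proof (em_tri _ _ Hd x y z hx hy hz) as H.
now rewrite !dfac_fin in H.
Qed.

(** The hypothesis covers quadruples with at most one infinite entry. In any other quadruple two
    entries coincide, and the inequality follows from symmetry and nonnegativity. *)
Lemma dfac_ptolemaic : ptolemy d Om -> ptolemaic (fun _ => True) (dfac d).
Proof.
intros Hp; split; intros; [apply dfac_ge0|apply dfac_eq0|apply dfac_sym|].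
assert (z0 : forall a, dfac d a a = 0) by (intros a; now apply dfac_eq0).
pose proof (em_Om_sub _ _ Hd) as u.
destruct (classic (atmost1 Om x y z w)) as [h|h]; [now apply Hp|].
assert (c : x = y \/ x = z \/ x = w \/ y = z \/ y = w \/ z = w).
{ apply NNPP; intros n; apply h; repeat split; intros [h1 h2]; apply n;
  rewrite (u _ _ h1 h2); tauto. }
assert (p : forall a b a' b', 0 <= dfac d a b * dfac d a' b')
  by (intros; apply Rmult_le_pos; apply dfac_ge0).
destruct c as [->|[->|[->|[->|[->| ->]]]]]; rewrite ?z0.
- pose proof (p y z y w); lra.
- rewrite (dfac_sym y z); lra.
- rewrite (dfac_sym z w), (dfac_sym y w); lra.
- lra.
- rewrite (dfac_sym z w); lra.
- pose proof (p x w y w); lra.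
Qed.

Lemma ball_dfac (x y : X) (r : R) : ~ Om x -> ball d x r y <-> ~ Om y /\ dfac d x y < r.
Proof.
intros hx; unfold ball; destruct (classic (Om y)) as [hy|hy].
- rewrite (proj1 (em_inf _ _ Hd x y hx hy)); simpl; tauto.
- rewrite (dfac_fin x y hx hy); simpl; tauto.
Qed.

Lemma coball_dfac (x y : X) (r : R) : ~ Om x -> coball d x r y <-> Om y \/ r < dfac d x y.
Proof.
intros hx; unfold coball; destruct (classic (Om y)) as [hy|hy].
- rewrite (proj1 (em_inf _ _ Hd x y hx hy)); simpl; tauto.
- rewrite (dfac_fin x y hx hy); simpl; tauto.
Qed.

(* By the cancellation convention the ratio tends to 1 at infinity. *)
Lemma open_ratio_lt (x z : X) (k : R) : x <> z -> 0 < k ->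
  ext_open d Om (fun u => dfac d x u < k * dfac d z u).
Proof.
intros xz k0 u hu.
destruct (classic (Om x)) as [hx|hx]; [|destruct (classic (Om z)) as [hz|hz]].
- assert (hz : ~ Om z) by (intros hz; apply xz; now apply (em_Om_sub _ _ Hd)).
  exists z, (/ k); split; [easy|split; [now apply Rinv_0_lt_compat|right]].
  assert (eqv : forall v, coball d z (/ k) v <-> dfac d x v < k * dfac d z v).
  { intros v; rewrite coball_dfac by easy; destruct (classic (Om v)) as [hv|hv].
    - rewrite (proj2 (dfac_inf_diag x v hx hv)), dfac_inf_r by easy; split; [lra|tauto].
    - rewrite (dfac_inf_l x v) by easy.
      split; [intros [|h]; [easy|]|intros h; right].
      + apply (Rmult_lt_compat_l k) in h; [|easy]; rewrite Rinv_r in h; lra.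
      + apply (Rmult_lt_reg_l k); [easy|]; rewrite Rinv_r; lra. }
  split; [now apply eqv|intros v; apply eqv].
- exists x, k; split; [easy|split; [easy|left]].
  assert (eqv : forall v, ball d x k v <-> dfac d x v < k * dfac d z v).
  { intros v; rewrite ball_dfac by easy; destruct (classic (Om v)) as [hv|hv].
    - rewrite (proj2 (dfac_inf_diag z v hz hv)), dfac_inf_r by easy; split; [tauto|lra].
    - rewrite (dfac_inf_l z v) by easy; split; [lra|split; [easy|lra]]. }
  split; [now apply eqv|intros v; apply eqv].
- destruct (classic (Om u)) as [hu'|hu'].
  + rewrite !dfac_inf_r in hu by easy.
    (* At an infinite [u] the hypothesis reads [1 < k]. Beyond this radius around [z],
       [d(x,z) + d(z,v) < k d(z,v)]; the maximum with 1 makes the radius positive. *)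
    exists z, (Rmax (dfac d x z / (k - 1)) 1); split; [easy|split].
    { pose proof (Rmax_r (dfac d x z / (k - 1)) 1); lra. }
    right; split; [now apply coball_dfac; auto|].
    intros v; rewrite coball_dfac by easy.
    destruct (classic (Om v)) as [hv|hv]; [intros _; rewrite !dfac_inf_r by easy; lra|].
    intros [|h]; [easy|]; pose proof (Rmax_l (dfac d x z / (k - 1)) 1).
    assert (dfac d x z < (k - 1) * dfac d z v).
    { rewrite Rmult_comm; apply Rlt_div_l; lra. }
    pose proof (dfac_tri x z v hx hz hv); lra.
  + set (r := (k * dfac d z u - dfac d x u) / (1 + k)).
    assert (r0 : 0 < r) by (apply Rdiv_lt_0_compat; lra).
    assert (er : r * (1 + k) = k * dfac d z u - dfac d x u) by (unfold r; field; lra).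
    exists u, r; split; [easy|split; [easy|left]].
    split; [apply ball_dfac; [easy|]; split; [easy|]|].
    { now rewrite (proj2 (dfac_eq0 u u) eq_refl). }
    intros v; rewrite ball_dfac by easy; intros [hv h].
    pose proof (dfac_tri x u v hx hu' hv); pose proof (dfac_tri z v u hz hv hu').
    rewrite (dfac_sym v u) in *. nra.
Qed.

(** Cover [X] by the [e / 2]-balls of the inverted metric and one neighbourhood of [o] that the
    bounded sequence avoids. In a finite subcover, two terms fall into the same ball. *)
Lemma bounded_inversion_clusters (Hc : ext_compact d Om) (Hp : ptolemy d Om)
  (o x : X) (xo : x <> o) (p : nat -> X) (r e : R) : 0 < e ->
  (forall n, p n <> o /\ inversion (dfac d) o x (p n) <= r) ->
  exists n m, (n < m)%nat /\ inversion (dfac d) o (p n) (p m) < e.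
Proof.
intros e0 hp.
pose proof (dfac_ptolemaic Hp) as Q.
set (q := dfac d) in *; set (D := inversion q o) in *.
assert (pos : forall a b, a <> b -> 0 < q a b) by (intros a b n; now apply semimetric_pos).
pose proof (inversion_ptolemaic q Q o) as M; fold D in M.
set (r' := Rmax r 1); assert (r'0 : 0 < r') by (pose proof (Rmax_r r 1); fold r' in H; lra).
assert (c0 : 0 < r' * q x o) by (apply Rmult_lt_0_compat; auto).
(* For [u <> o] these say [D i u < e / 2] and, for the index [o], [D x u > r']. Clearing
   denominators makes them ratio conditions, open by [open_ratio_lt]. *)
set (U := fun i u => (i <> o /\ q i u < e / 2 * q i o * q o u) \/
                     (i = o /\ q o u < / (r' * q x o) * q x u)).
destruct (Hc X U) as [l hl].
{ intros i; destruct (classic (i = o)) as [io|io]; intros u [[h1 h2]|[h1 h2]]; try easy.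
  - destruct (open_ratio_lt o x (/ (r' * q x o)) (not_eq_sym xo)
      ltac:(now apply Rinv_0_lt_compat) u h2) as [b [s [hb [s0 H]]]].
    exists b, s; split; [easy|split; [easy|]].
    destruct H as [[H1 H2]|[H1 H2]]; [left|right]; (split; [easy|]);
      intros v hv; right; split; auto.
  - assert (k0 : 0 < e / 2 * q i o) by (apply Rmult_lt_0_compat; [lra|auto]).
    destruct (open_ratio_lt i o _ io k0 u h2) as [b [s [hb [s0 H]]]].
    exists b, s; split; [easy|split; [easy|]].
    destruct H as [[H1 H2]|[H1 H2]]; [left|right]; (split; [easy|]);
      intros v hv; left; split; auto. }
{ intros u; destruct (classic (u = o)) as [->|uo].
  - exists o; right; split; [easy|].
    rewrite (proj2 (pt_eq0 _ _ Q o o I I) eq_refl).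
    apply Rmult_lt_0_compat; [now apply Rinv_0_lt_compat|auto].
  - exists u; left; split; [easy|].
    rewrite (proj2 (pt_eq0 _ _ Q u u I I) eq_refl).
    repeat apply Rmult_lt_0_compat; auto; lra. }
assert (near : forall n, exists i, In i l /\ i <> o /\ D i (p n) < e / 2).
{ intros n; destruct (hp n) as [po bd]; destruct (hl (p n)) as [i [il [[io h]|[io h]]]].
  - exists i; split; [easy|split; [easy|]].
    unfold D, inversion; rewrite (pt_sym _ _ Q (p n) o I I).
    apply Rlt_div_l; [apply Rmult_lt_0_compat; auto|lra].
  - exfalso; apply (Rmult_lt_compat_l (r' * q x o)) in h; [|easy].
    rewrite <- Rmult_assoc, Rinv_r, Rmult_1_l in h by lra.
    unfold D, inversion in bd; apply Rle_div_l in bd; [|apply Rmult_lt_0_compat; auto].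
    rewrite (pt_sym _ _ Q (p n) o I I) in bd.
    assert (0 < q x o * q o (p n)) by (apply Rmult_lt_0_compat; auto).
    pose proof (Rmax_l r 1); fold r' in H0.
    assert (r * (q x o * q o (p n)) <= r' * (q x o * q o (p n)))
      by (apply Rmult_le_compat_r; lra).
    lra. }
set (c := fun n => proj1_sig (constructive_indefinite_description _ (near n))).
assert (hc : forall n, In (c n) l /\ c n <> o /\ D (c n) (p n) < e / 2)
  by (intros n; exact (proj2_sig (constructive_indefinite_description _ (near n)))).
clearbody c.
assert (pigeon : exists n m, (n < m)%nat /\ c n = c m).
{ apply NNPP; intros N.
  assert (nd : NoDup (map c (seq 0 (S (length l))))).
  { apply NoDup_map_NoDup_ForallPairs; [|apply seq_NoDup].
    intros a b _ _ ab; destruct (Nat.lt_trichotomy a b) as [h|[h|h]]; [|easy|];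
    exfalso; apply N; eauto. }
  apply NoDup_incl_length with (l' := l) in nd.
  - rewrite length_map, length_seq in nd; lia.
  - intros a ha; apply in_map_iff in ha; destruct ha as [n [<- _]]; apply hc. }
destruct pigeon as [n [m [nm cnm]]]; exists n, m; split; [easy|].
destruct (hc n) as [_ [h1 h2]], (hc m) as [_ [h3 h4]], (hp n) as [h5 _], (hp m) as [h6 _].
rewrite <- cnm in h4.
pose proof (inversion_triangle q Q o (p n) (c n) (p m) h5 h1 h6) as T; fold D in T.
rewrite (pt_sym _ _ M (p n) (c n) h5 h1) in T; lra.
Qed.
End Ext.

(** * Chords of the unit circle *)

(** Twice the signed area of the triangle; the sign tells on which side of the line [ab] the point
    [c] lies. *)
Definition orient (a b c : R * R) : R :=
  (fst b - fst a) * (snd c - snd a) - (snd b - snd a) * (fst c - fst a).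

Lemma sum_squares_pos (u v : R) : (u = 0 -> v = 0 -> False) -> 0 < u ^ 2 + v ^ 2.
Proof.
intros h; destruct (Req_dec u 0) as [hu|hu];
  [destruct (Req_dec v 0) as [hv|hv]; [destruct (h hu hv)|]|].
- apply Rsqr_pos_lt in hv; unfold Rsqr in hv; nra.
- apply Rsqr_pos_lt in hu; unfold Rsqr in hu; nra.
Qed.

(** For the chord vectors [x = b - a] and [y = c - a], the unit circle gives [2 a.x = -|x|^2] and
    [2 a.y = -|y|^2]. If [x] and [y] were parallel, then [x |y|^2 = y |x|^2], so
    [x.y = |x|^2 = |y|^2] and [x = y]. *)
Lemma orient_neq0 (a b c : R * R) : S1 a -> S1 b -> S1 c ->
  a <> b -> a <> c -> b <> c -> orient a b c <> 0.
Proof.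
destruct a as [a1 a2], b as [b1 b2], c as [c1 c2]; unfold S1, orient; simpl.
intros ha hb hc nab nac nbc h.
assert (sq : forall u1 u2 v1 v2, (u1, u2) <> (v1, v2) ->
    0 < (v1 - u1) ^ 2 + (v2 - u2) ^ 2).
{ intros u1 u2 v1 v2 n; apply sum_squares_pos; intros e1 e2; apply n.
  f_equal; lra. }
pose proof (sq _ _ _ _ nab) as pb; pose proof (sq _ _ _ _ nac) as pc.
pose proof (sq _ _ _ _ nbc) as pbc.
set (x1 := b1 - a1) in *; set (x2 := b2 - a2) in *.
set (y1 := c1 - a1) in *; set (y2 := c2 - a2) in *.
assert (eb : 2 * (a1 * x1 + a2 * x2) = - (x1 ^ 2 + x2 ^ 2)) by (unfold x1, x2; nra).
assert (ec : 2 * (a1 * y1 + a2 * y2) = - (y1 ^ 2 + y2 ^ 2)) by (unfold y1, y2; nra).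
assert (e1 : x1 * (y1 ^ 2 + y2 ^ 2) = y1 * (x1 ^ 2 + x2 ^ 2)).
{ replace (y1 ^ 2 + y2 ^ 2) with (- (2 * (a1 * y1 + a2 * y2))) by lra.
  replace (x1 ^ 2 + x2 ^ 2) with (- (2 * (a1 * x1 + a2 * x2))) by lra.
  replace (x1 * - (2 * (a1 * y1 + a2 * y2))) with
    (- 2 * (a1 * x1 * y1 + a2 * (x1 * y2))) by ring.
  replace (x1 * y2) with (x2 * y1) by lra. ring. }
assert (e2 : x2 * (y1 ^ 2 + y2 ^ 2) = y2 * (x1 ^ 2 + x2 ^ 2)).
{ replace (y1 ^ 2 + y2 ^ 2) with (- (2 * (a1 * y1 + a2 * y2))) by lra.
  replace (x1 ^ 2 + x2 ^ 2) with (- (2 * (a1 * x1 + a2 * x2))) by lra.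
  replace (x2 * - (2 * (a1 * y1 + a2 * y2))) with
    (- 2 * (a1 * (x2 * y1) + a2 * x2 * y2)) by ring.
  replace (x2 * y1) with (x1 * y2) by lra. ring. }
assert (i1 : x1 * y1 + x2 * y2 = x1 ^ 2 + x2 ^ 2).
{ apply (Rmult_eq_reg_r (y1 ^ 2 + y2 ^ 2)); [|lra].
  replace ((x1 * y1 + x2 * y2) * (y1 ^ 2 + y2 ^ 2)) with
    (y1 * (x1 * (y1 ^ 2 + y2 ^ 2)) + y2 * (x2 * (y1 ^ 2 + y2 ^ 2))) by ring.
  rewrite e1, e2; ring. }
assert (i2 : x1 * y1 + x2 * y2 = y1 ^ 2 + y2 ^ 2).
{ apply (Rmult_eq_reg_r (x1 ^ 2 + x2 ^ 2)); [|lra].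
  replace ((x1 * y1 + x2 * y2) * (x1 ^ 2 + x2 ^ 2)) with
    (x1 * (y1 * (x1 ^ 2 + x2 ^ 2)) + x2 * (y2 * (x1 ^ 2 + x2 ^ 2))) by ring.
  rewrite <- e1, <- e2; ring. }
replace (c1 - b1) with (y1 - x1) in pbc by (unfold x1, y1; ring).
replace (c2 - b2) with (y2 - x2) in pbc by (unfold x2, y2; ring).
nra.
Qed.

(** A sign argument: if the first two products are nonnegative, [orient a b e] has the sign of
    [orient a b c] and [orient a c e] the opposite one, so the third product is negative. *)
Lemma separated_pairs (a b c e : R * R) :
  orient a b c <> 0 -> orient a b e <> 0 -> orient a c e <> 0 ->
  orient a b c * orient a b e < 0 \/
  orient a c b * orient a c e < 0 \/
  orient a e b * orient a e c < 0.
Proof.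
intros h1 h2 h3.
assert (orient a c b = - orient a b c) by (unfold orient; ring).
assert (orient a e b = - orient a b e) by (unfold orient; ring).
assert (orient a e c = - orient a c e) by (unfold orient; ring).
destruct (Rlt_le_dec (orient a b c * orient a b e) 0) as [|p1]; [now left|right].
destruct (Rlt_le_dec (orient a c b * orient a c e) 0) as [|p2]; [now left|right].
rewrite H in p2; rewrite H0, H1.
revert h1 h2 h3 p1 p2; generalize (orient a b c) (orient a b e) (orient a c e).
intros u v w; intros.
destruct (Rtotal_order u 0) as [hu|[hu|hu]]; [|lra|];
destruct (Rtotal_order v 0) as [hv|[hv|hv]]; try lra; try nra;
destruct (Rtotal_order w 0) as [hw|[hw|hw]]; try lra; nra.
Qed.

Lemma eopen_orient_pos (a b : R * R) : eopen (fun c => 0 < orient a b c).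
Proof.
destruct a as [a1 a2], b as [b1 b2]; intros [p1 p2]; unfold orient; simpl; intros h.
set (l := (b1 - a1) * (p2 - a2) - (b2 - a2) * (p1 - a1)) in *.
set (m := Rabs (b1 - a1) + Rabs (b2 - a2) + 1).
assert (m0 : 0 < m).
{ unfold m; pose proof (Rabs_pos (b1 - a1)); pose proof (Rabs_pos (b2 - a2)); lra. }
exists (l / m); split; [now apply Rdiv_lt_0_compat|].
intros [q1 q2]; simpl; intros hq.
assert (lm : 0 < l / m) by now apply Rdiv_lt_0_compat.
destruct (triangle_rectangle_lt (q1 - p1) (q2 - p2) (l / m)) as [h1 h2];
  [unfold Rsqr; lra|].
rewrite (Rabs_pos_eq (l / m)) in h1, h2 by lra.
assert (k1 : Rabs ((b1 - a1) * (q2 - p2)) <= Rabs (b1 - a1) * (l / m)).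
{ rewrite Rabs_mult; apply Rmult_le_compat_l; [apply Rabs_pos|lra]. }
assert (k2 : Rabs ((b2 - a2) * (q1 - p1)) <= Rabs (b2 - a2) * (l / m)).
{ rewrite Rabs_mult; apply Rmult_le_compat_l; [apply Rabs_pos|lra]. }
apply Rcomplements.Rabs_le_between in k1; apply Rcomplements.Rabs_le_between in k2.
assert (e : l = (Rabs (b1 - a1) + Rabs (b2 - a2) + 1) * (l / m))
  by (fold m; field; lra).
assert (l - ((b1 - a1) * (q2 - a2) - (b2 - a2) * (q1 - a1)) =
  - ((b1 - a1) * (q2 - p2)) + (b2 - a2) * (q1 - p1)) by (unfold l; ring).
lra.
Qed.

(* The second intersection with the unit circle of the line joining its point
   [c] to the point [(1 - t) a + t b] of a chord. *)
Definition project_chord (a b c : R * R) (t : R) : R * R :=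
  let u := (1 - t) * fst a + t * fst b - fst c in
  let v := (1 - t) * snd a + t * snd b - snd c in
  let m := - 2 * (fst c * u + snd c * v) / (u ^ 2 + v ^ 2) in
  (fst c + m * u, snd c + m * v).

Lemma chord_neq (a b c : R * R) (t : R) : orient a b c <> 0 ->
  0 < ((1 - t) * fst a + t * fst b - fst c) ^ 2
      + ((1 - t) * snd a + t * snd b - snd c) ^ 2.
Proof.
destruct a as [a1 a2], b as [b1 b2], c as [c1 c2]; unfold orient; simpl; intros h.
set (u := _ - c1); set (v := _ - c2).
apply sum_squares_pos; intros hu hv; apply h.
replace c1 with ((1 - t) * a1 + t * b1) by (unfold u in hu; lra).
replace c2 with ((1 - t) * a2 + t * b2) by (unfold v in hv; lra).
ring.
Qed.

Lemma project_chord_S1 (a b c : R * R) (t : R) : S1 c -> orient a b c <> 0 ->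
  S1 (project_chord a b c t).
Proof.
intros hc h; apply (chord_neq a b c t) in h; revert h.
unfold project_chord, S1 in *; simpl fst; simpl snd.
set (u := _ + _ - fst c); set (v := _ + _ - snd c); intros h.
replace (_ ^ 2 + _ ^ 2) with (fst c ^ 2 + snd c ^ 2); [easy|].
field; simpl in h |- *; lra.
Qed.

Lemma project_chord_0 (a b c : R * R) : S1 a -> S1 c -> orient a b c <> 0 ->
  project_chord a b c 0 = a.
Proof.
intros ha hc h; apply (chord_neq a b c 0) in h; revert h.
unfold project_chord, S1 in *; simpl fst; simpl snd.
replace ((1 - 0) * fst a + 0 * fst b - fst c) with (fst a - fst c) by ring.
replace ((1 - 0) * snd a + 0 * snd b - snd c) with (snd a - snd c) by ring.
intros h.
replace (-2 * (fst c * (fst a - fst c) + snd c * (snd a - snd c)))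
  with ((fst a - fst c) ^ 2 + (snd a - snd c) ^ 2) by nra.
unfold Rdiv; rewrite Rinv_r by lra.
destruct a; simpl; f_equal; ring.
Qed.

Lemma project_chord_1 (a b c : R * R) : S1 b -> S1 c -> orient a b c <> 0 ->
  project_chord a b c 1 = b.
Proof.
intros ha hc h; apply (chord_neq a b c 1) in h; revert h.
unfold project_chord, S1 in *; simpl fst; simpl snd.
replace ((1 - 1) * fst a + 1 * fst b - fst c) with (fst b - fst c) by ring.
replace ((1 - 1) * snd a + 1 * snd b - snd c) with (snd b - snd c) by ring.
intros h.
replace (-2 * (fst c * (fst b - fst c) + snd c * (snd b - snd c)))
  with ((fst b - fst c) ^ 2 + (snd b - snd c) ^ 2) by nra.
unfold Rdiv; rewrite Rinv_r by lra.
destruct b; simpl; f_equal; ring.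
Qed.

(** An interior point of the chord lies inside the disc, so the ray from [c] crosses the chord at
    parameter 1 and leaves the disc at some [m > 1]. Being affine along the ray, [orient a b] is
    multiplied by [1 - m]. *)
Lemma project_chord_opposite (a b c : R * R) (t : R) : S1 a -> S1 b -> S1 c ->
  orient a b c <> 0 -> 0 < t < 1 ->
  orient a b c * orient a b (project_chord a b c t) < 0.
Proof.
intros ha hb hc h ht; pose proof (chord_neq a b c t h) as p; revert p.
assert (ab : 0 < (fst a - fst b) ^ 2 + (snd a - snd b) ^ 2).
{ apply sum_squares_pos; intros e1 e2; apply h; unfold orient.
  replace (fst b) with (fst a) by lra; replace (snd b) with (snd a) by lra; ring. }
unfold project_chord, S1 in *; simpl fst; simpl snd.
set (u := _ + _ - fst c); set (v := _ + _ - snd c); intros p.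
set (m := _ / _).
assert (inside : (fst c + u) ^ 2 + (snd c + v) ^ 2 < 1).
{ assert ((fst c + u) ^ 2 + (snd c + v) ^ 2
    = (1 - t) * (fst a ^ 2 + snd a ^ 2) + t * (fst b ^ 2 + snd b ^ 2)
      - t * (1 - t) * ((fst a - fst b) ^ 2 + (snd a - snd b) ^ 2)) as ->
    by (unfold u, v; ring).
  rewrite ha, hb; assert (0 < t * (1 - t)) by nra; nra. }
assert (hm : 1 < m).
{ unfold m; apply (Rmult_lt_reg_r (u ^ 2 + v ^ 2)); [easy|].
  unfold Rdiv; rewrite Rmult_assoc, Rinv_l by lra. nra. }
replace (orient a b (fst c + m * u, snd c + m * v)) with ((1 - m) * orient a b c)
  by (unfold orient, u, v; simpl; ring).
assert (0 < orient a b c * orient a b c) by nra.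
nra.
Qed.

Lemma project_chord_continuous (a b c : R * R) (U : R * R -> Prop) (t : R) :
  orient a b c <> 0 -> eopen U -> U (project_chord a b c t) ->
  exists e, 0 < e /\ forall t', Rabs (t' - t) < e -> U (project_chord a b c t').
Proof.
intros h oU Ut; destruct (oU _ Ut) as [e [e0 he]].
assert (c1 : continuity_pt (fun t => fst (project_chord a b c t)) t).
{ pose proof (chord_neq a b c t h); unfold project_chord; simpl.
  reg; simpl in *; lra. }
assert (c2 : continuity_pt (fun t => snd (project_chord a b c t)) t).
{ pose proof (chord_neq a b c t h); unfold project_chord; simpl.
  reg; simpl in *; lra. }
destruct (c1 (e / 2) ltac:(lra)) as [r1 [r10 h1]].
destruct (c2 (e / 2) ltac:(lra)) as [r2 [r20 h2]].
exists (Rmin r1 r2); split; [now apply Rmin_glb_lt|].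
intros t' ht'; apply he.
destruct (Req_dec t' t) as [->|n]; [nra|].
pose proof (Rmin_l r1 r2); pose proof (Rmin_r r1 r2).
assert (k1 : Rabs (fst (project_chord a b c t') - fst (project_chord a b c t)) < e / 2)
  by exact (h1 t' (conj (conj I (not_eq_sym n)) (Rlt_le_trans _ _ _ ht' H))).
assert (k2 : Rabs (snd (project_chord a b c t') - snd (project_chord a b c t)) < e / 2)
  by exact (h2 t' (conj (conj I (not_eq_sym n)) (Rlt_le_trans _ _ _ ht' H0))).
apply Rabs_def2 in k1; apply Rabs_def2 in k2.
set (u := fst _ - _) in *; set (v := snd _ - _) in *; nra.
Qed.

(** * Arcs of circles *)

Section Circles.
Context {X : Type} (d : X -> X -> Rbar) (Om : X -> Prop).
Context (Hd : ext_metric d Om) (Hp : ptolemy d Om).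
Let q := dfac d.
Let Q : ptolemaic (fun _ => True) q := dfac_ptolemaic d Om Hd Hp.
Let D := inversion q.

(** The body of [homeo_S1] for fixed [f] and [g], so that positions on [s] can be compared through
    [orient]. *)
Definition circle_coords (s : X -> Prop) (f : R * R -> X) (g : X -> R * R) : Prop :=
  (forall p, S1 p -> s (f p)) /\ (forall x, s x -> S1 (g x)) /\
  (forall p, S1 p -> g (f p) = p) /\ (forall x, s x -> f (g x) = x) /\
  (forall V, ext_open d Om V -> exists U, eopen U /\ forall p, S1 p -> (V (f p) <-> U p)) /\
  (forall U, eopen U -> exists V, ext_open d Om V /\ forall x, s x -> (U (g x) <-> V x)).

Lemma circle_coords_inj s f g x y : circle_coords s f g -> s x -> s y -> x <> y -> g x <> g y.
Proof.
intros (_ & _ & _ & fg & _) hx hy n e; apply n.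
rewrite <- (fg x hx), <- (fg y hy); now f_equal.
Qed.

Lemma circle_orient_neq0 s f g x y z : circle_coords s f g -> s x -> s y -> s z ->
  x <> y -> x <> z -> y <> z -> orient (g x) (g y) (g z) <> 0.
Proof.
intros C hx hy hz xy xz yz; pose proof C as (_ & gs & _).
apply orient_neq0; auto; now apply (circle_coords_inj s f g).
Qed.

(** The two open half-planes bounded by the chord pull back to open sets that would disconnect any
    subset of the punctured circle containing both [y] and [w]. *)
Lemma chord_separates s f g x z y w : circle_coords s f g -> s x -> s z -> x <> z ->
  orient (g x) (g z) (g y) < 0 -> 0 < orient (g x) (g z) (g w) ->
  ~ same_component d Om (fun a => s a /\ a <> x /\ a <> z) y w.
Proof.
intros C hx hz xz oy ow (A & sub & conn & Ay & Aw).
pose proof C as (_ & gs & _ & _ & _ & op).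
assert (neg : forall c, orient (g z) (g x) c = - orient (g x) (g z) c)
  by (intros c; unfold orient; ring).
destruct (op _ (eopen_orient_pos (g x) (g z))) as [V1 [o1 h1]].
destruct (op _ (eopen_orient_pos (g z) (g x))) as [V2 [o2 h2]].
apply (conn V1 V2 o1 o2).
- intros a Aa; destruct (sub a Aa) as [sa [ax az]].
  rewrite <- (h1 a sa), <- (h2 a sa), neg.
  pose proof (circle_orient_neq0 s f g x z a C hx hz sa xz (not_eq_sym ax) (not_eq_sym az)).
  lra.
- intros a Aa; destruct (sub a Aa) as [sa _].
  rewrite <- (h1 a sa), <- (h2 a sa), neg; lra.
- exists w; split; [easy|]; apply h1; [now apply sub|easy].
- exists y; split; [easy|]; apply h2; [now apply sub|]; rewrite neg; lra.
Qed.

Lemma chord_ptolemy_eq s f g x z y w : is_circle d Om s -> circle_coords s f g ->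
  s x -> s y -> s z -> s w -> x <> y -> x <> z -> x <> w -> y <> z -> y <> w -> z <> w ->
  orient (g x) (g z) (g y) * orient (g x) (g z) (g w) < 0 ->
  q x z * q y w = q x y * q z w + q x w * q y z.
Proof.
intros [_ S] C hx hy hz hw xy xz xw yz yw zw h.
assert (c : orient (g x) (g z) (g y) < 0 /\ 0 < orient (g x) (g z) (g w) \/
            0 < orient (g x) (g z) (g y) /\ orient (g x) (g z) (g w) < 0).
{ pose proof (circle_orient_neq0 s f g x z y C hx hz hy xz xy (not_eq_sym yz)).
  destruct (Rtotal_order (orient (g x) (g z) (g y)) 0) as [k|[k|k]]; [left|easy|right];
  split; nra. }
destruct c as [[c1 c2]|[c1 c2]].
- apply S; auto; now apply (chord_separates s f g).
- assert (E : q x z * q w y = q x w * q z y + q x y * q w z).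
  { apply S; auto; now apply (chord_separates s f g). }
  unfold q in *.
  rewrite (dfac_sym d Om Hd w y), (dfac_sym d Om Hd w z), (dfac_sym d Om Hd z y) in E; lra.
Qed.

(** One of the three pairings consists of crossing chords, by [separated_pairs]; no cyclic order has
    to be tracked. *)
Lemma circle_four s x y z w : is_circle d Om s ->
  s x -> s y -> s z -> s w -> x <> y -> x <> z -> x <> w -> y <> z -> y <> w -> z <> w ->
  q x z * q y w = q x y * q z w + q x w * q y z \/
  q x y * q z w = q x z * q y w + q x w * q y z \/
  q x w * q y z = q x z * q y w + q x y * q z w.
Proof.
intros S hx hy hz hw xy xz xw yz yw zw; pose proof S as [(f & g & C) _].
change (circle_coords s f g) in C.
assert (sym := fun a b => dfac_sym d Om Hd a b).
destruct (separated_pairs (g x) (g z) (g y) (g w)) as [h|[h|h]];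
  try (apply (circle_orient_neq0 s f g); auto).
- left; now apply (chord_ptolemy_eq s f g).
- right; left; assert (E : q x y * q z w = q x z * q y w + q x w * q z y)
    by (apply (chord_ptolemy_eq s f g); auto).
  unfold q in *; rewrite (sym z y) in E; easy.
- right; right; assert (E : q x w * q z y = q x z * q w y + q x y * q z w)
    by (apply (chord_ptolemy_eq s f g); auto).
  unfold q in *; rewrite (sym z y), (sym w y) in E; easy.
Qed.

(** With [o] at infinity, the rest of the circle behaves like a line: of three points, one is
    between the others. *)
Lemma circle_three s o x y z : is_circle d Om s ->
  s o -> s x -> s y -> s z -> x <> o -> y <> o -> z <> o -> x <> y -> x <> z -> y <> z ->
  D o x z = D o x y + D o y z \/ D o y z = D o y x + D o x z \/ D o x y = D o x z + D o z y.
Proof.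
intros S ho hx hy hz xo yo zo xy xz yz; unfold D.
rewrite <- !(inversion_additive q Q o) by easy.
pose proof (circle_four s x y z o S hx hy hz ho xy xz xo yz yo zo) as F.
unfold q in *.
rewrite (dfac_sym d Om Hd y x), (dfac_sym d Om Hd z y); lra.
Qed.

Lemma inversion_four_eq o x y z w : x <> o -> y <> o -> z <> o -> w <> o ->
  q x z * q y w = q x y * q z w + q x w * q y z ->
  D o x z * D o y w = D o x y * D o z w + D o x w * D o y z.
Proof.
intros xo yo zo wo h; unfold D, inversion.
pose proof (semimetric_pos q Q x o xo); pose proof (semimetric_pos q Q y o yo).
pose proof (semimetric_pos q Q z o zo); pose proof (semimetric_pos q Q w o wo).
transitivity ((q x z * q y w) / (q x o * q y o * q z o * q w o)); [field; lra|].
rewrite h; field; lra.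
Qed.

(** The condition on [y] singles out the point between [x] and [y], as [s] may have another point at
    distance [t] on the far side of [x]. *)
Definition arc_point (s : X -> Prop) (o x y : X) (t : R) (w : X) : Prop :=
  s w /\ w <> o /\ D o x w = t /\ D o w y = D o x y - t.

(** Betweenness with [x] leaves [|t - t'|] or [t + t'], and with [y] it leaves [|t - t'|] or
    [2 D(x,y) - t - t']. The values other than [|t - t'|] agree only if [t + t' = D(x,y)], Menger's
    pseudo-linear quadruple. *)
Lemma arc_dist s o x y t t' w w' : is_circle d Om s -> s o -> s x -> s y ->
  x <> o -> y <> o -> x <> y -> 0 < t < D o x y -> 0 < t' < D o x y ->
  arc_point s o x y t w -> arc_point s o x y t' w' -> D o w w' = Rabs (t - t').
Proof.
intros S ho hx hy xo yo xy ht ht' (hw & wo & xw & wy) (hw' & wo' & xw' & wy').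
pose proof (inversion_ptolemaic q Q o) as M; fold (D o) in M.
assert (z0 : forall a, a <> o -> D o a a = 0) by (intros a h; now apply M).
destruct (classic (w = w')) as [<-|n].
{ rewrite z0 by easy; replace (t - t') with 0 by lra; now rewrite Rabs_R0. }
assert (nx : forall u a, D o x u = a -> 0 < a -> x <> u)
  by (intros u a h h' <-; rewrite z0 in h; [lra|easy]).
assert (ny : forall u a, D o u y = D o x y - a -> a < D o x y -> y <> u)
  by (intros u a h h' <-; rewrite z0 in h; [lra|easy]).
pose proof (nx w t xw ltac:(lra)) as xnw; pose proof (nx w' t' xw' ltac:(lra)) as xnw'.
pose proof (ny w t wy ltac:(lra)) as ynw; pose proof (ny w' t' wy' ltac:(lra)) as ynw'.
pose proof (circle_three s o x w w' S ho hx hw hw' xo wo wo' xnw xnw' n) as T1.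
pose proof (circle_three s o y w w' S ho hy hw hw' yo wo wo' ynw ynw' n) as T2.
rewrite (pt_sym _ _ M w x wo xo), (pt_sym _ _ M w' w wo' wo), xw, xw' in T1.
rewrite (pt_sym _ _ M w' w wo' wo), (pt_sym _ _ M y w yo wo),
  (pt_sym _ _ M y w' yo wo'), wy, wy' in T2.
pose proof (pt_ge0 _ _ M w w' wo wo') as pos.
destruct (Req_dec (D o w w') (t + t')) as [e|e];
  [|destruct (Rle_dec t t'); [rewrite Rabs_left1|rewrite Rabs_pos_eq]; lra].
destruct (Req_dec (t + t') (D o x y)) as [e'|e'];
  [|destruct (Rle_dec t t'); [rewrite Rabs_left1|rewrite Rabs_pos_eq]; lra].
(* [w] and [w'] would be antipodal, contradicting Ptolemy on [x, y, w, w']. *)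
exfalso.
destruct (circle_four s x w y w' S hx hw hy hw' xnw xy xnw' (not_eq_sym ynw) n ynw')
  as [F|[F|F]].
- apply (inversion_four_eq o) in F; auto.
  rewrite (pt_sym _ _ M y w' yo wo'), xw, xw', wy, wy' in F. nra.
- assert (F' : D o x w * D o y w' = D o x y * D o w w' + D o x w' * D o y w).
  { apply inversion_four_eq; auto. unfold q in *.
    rewrite (dfac_sym d Om Hd y w); lra. }
  rewrite (pt_sym _ _ M y w' yo wo'), (pt_sym _ _ M y w yo wo), xw, xw', wy, wy' in F'. nra.
- assert (F' : D o x w' * D o w y = D o x w * D o w' y + D o x y * D o w w').
  { apply inversion_four_eq; auto. unfold q in *.
    rewrite (dfac_sym d Om Hd w' y); lra. }
  rewrite xw, xw', wy, wy' in F'. nra.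
Qed.

(** Upper and lower bounds on the ratio are both instances of [open_ratio_lt], with [x] and [o]
    exchanged; this treats the infinite point uniformly. *)
Lemma ratio_continuous (c : R -> X) (x o : X) (t : R) : x <> o -> c t <> o ->
  (forall V, ext_open d Om V -> V (c t) ->
    exists e, 0 < e /\ forall t', Rabs (t' - t) < e -> V (c t')) ->
  continuity_pt (fun t => q x (c t) / q o (c t)) t.
Proof.
intros xo co hc e e0; simpl; unfold Rdist.
assert (pos : forall a b, a <> b -> 0 < q a b) by (intros a b n; now apply semimetric_pos).
assert (nn : forall a b, 0 <= q a b) by (intros; now apply Q).
set (r := q x (c t) / q o (c t)).
assert (er : q x (c t) = r * q o (c t)).
{ unfold r; field; apply Rgt_not_eq, pos; auto. }
assert (r0 : 0 <= r) by (apply Rdiv_le_0_compat; auto).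
pose proof (pos o (c t) (not_eq_sym co)) as oc.
assert (up : exists a, 0 < a /\ forall t', Rabs (t' - t) < a ->
    0 < q o (c t') /\ q x (c t') / q o (c t') < r + e).
{ destruct (hc _ (open_ratio_lt d Om Hd x o (r + e) xo ltac:(lra))) as [a [a0 h]].
  - fold q; rewrite er; nra.
  - exists a; split; [easy|]; intros t' ht'; specialize (h t' ht'); fold q in h.
    pose proof (nn x (c t')); assert (p : 0 < q o (c t')) by nra.
    split; [easy|now apply Rlt_div_l]. }
destruct up as [a [a0 ha]].
(* If [r < e], the lower bound is nonnegativity of the ratio. Otherwise [r - e / 2] is a positive
   constant, as [open_ratio_lt] requires. *)
destruct (Rlt_le_dec r e) as [re|re].
- exists a; split; [easy|]; intros t' [_ ht']; destruct (ha t' ht') as [p h].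
  pose proof (Rdiv_le_0_compat _ _ (nn x (c t')) p); fold r.
  apply Rabs_def1; lra.
- assert (k0 : 0 < r - e / 2) by lra.
  destruct (hc _ (open_ratio_lt d Om Hd o x (/ (r - e / 2)) (not_eq_sym xo)
    (Rinv_0_lt_compat _ k0))) as [b [b0 hb]].
  { fold q; rewrite er; apply (Rmult_lt_reg_l (r - e / 2)); [easy|].
    rewrite <- Rmult_assoc, Rinv_r, Rmult_1_l by lra; nra. }
  exists (Rmin a b); split; [now apply Rmin_glb_lt|].
  intros t' [_ ht']; fold r.
  destruct (ha t' (Rlt_le_trans _ _ _ ht' (Rmin_l a b))) as [p h].
  specialize (hb t' (Rlt_le_trans _ _ _ ht' (Rmin_r a b))); fold q in hb.
  apply (Rmult_lt_compat_l (r - e / 2)) in hb; [|easy].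
  rewrite <- Rmult_assoc, Rinv_r, Rmult_1_l in hb by lra.
  apply Rlt_div_r in hb; [|easy].
  apply Rabs_def1; lra.
Qed.

(** [project_chord] runs from [x] to [y] along the arc avoiding [o]. The intermediate value theorem
    yields distance [t] from [x]; since the chord [xy] separates [o] from the point found, distances
    add up. *)
Lemma arc_exists s o x y t : is_circle d Om s -> s o -> s x -> s y ->
  x <> o -> y <> o -> x <> y -> 0 < t < D o x y -> exists w, arc_point s o x y t w.
Proof.
intros S ho hx hy xo yo xy ht; pose proof S as [(f & g & C) _].
change (circle_coords s f g) in C; pose proof C as (fs & gs & gf & fg & cont & _).
pose proof (circle_orient_neq0 s f g x y o C hx hy ho xy xo yo) as or.
set (c := fun u => f (project_chord (g x) (g y) (g o) u)).
assert (cs : forall u, S1 (project_chord (g x) (g y) (g o) u))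
  by (intros u; apply project_chord_S1; auto).
assert (c0 : c 0 = x) by (unfold c; rewrite project_chord_0; auto).
assert (c1 : c 1 = y) by (unfold c; rewrite project_chord_1; auto).
assert (opp : forall u, 0 < u < 1 ->
    orient (g x) (g y) (g o) * orient (g x) (g y) (g (c u)) < 0).
{ intros u hu; unfold c; rewrite gf by auto; apply project_chord_opposite; auto. }
assert (co : forall u, 0 <= u <= 1 -> c u <> o).
{ intros u hu; destruct (Req_dec u 0) as [->|u0]; [now rewrite c0|].
  destruct (Req_dec u 1) as [->|u1]; [now rewrite c1|].
  intros e; specialize (opp u ltac:(lra)); rewrite e in opp.
  pose proof (Rle_0_sqr (orient (g x) (g y) (g o))) as sq; unfold Rsqr in sq; lra. }
pose proof (semimetric_pos q Q x o xo) as pxo; pose proof (semimetric_pos q Q y o yo) as pyo.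
assert (sym : forall a b, q a b = q b a) by (intros; now apply (dfac_sym d Om Hd)).
(* The function is [q x o] times [D o x (c u) - t]. *)
destruct (IVT_interv (fun u => q x (c u) / q o (c u) - t * q x o) 0 1) as [u [hu eu]].
- intros u hu; apply continuity_pt_minus; [|apply continuity_pt_const; easy].
  apply ratio_continuous; auto.
  intros V oV Vc; destruct (cont V oV) as [U [oU h]].
  destruct (project_chord_continuous (g x) (g y) (g o) U u or oU) as [e [e0 he]].
  + now apply h.
  + exists e; split; [easy|]; intros u' hu'; apply h; auto.
- lra.
- rewrite c0, (proj2 (pt_eq0 _ _ Q x x I I) eq_refl); unfold Rdiv; nra.
- rewrite c1, (sym o y); unfold D, inversion in ht.
  assert (e : q x y / q y o = q x y / (q x o * q y o) * q x o) by (field; lra).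
  rewrite e; nra.
- set (w := c u) in *; pose proof (co u hu) as wo; fold w in wo.
  pose proof (semimetric_pos q Q w o wo) as pwo.
  assert (xw : D o x w = t).
  { unfold D, inversion; rewrite (sym o w) in eu.
    apply (Rmult_eq_reg_r (q x o)); [|lra].
    transitivity (q x w / q w o); [field; lra|lra]. }
  pose proof (inversion_ptolemaic q Q o) as M; fold (D o) in M.
  assert (xnw : x <> w).
  { intros e; rewrite <- e, (proj2 (pt_eq0 _ _ M x x xo xo) eq_refl) in xw; lra. }
  assert (ynw : y <> w) by (intros e; rewrite <- e in xw; lra).
  assert (u01 : 0 < u < 1).
  { destruct (Req_dec u 0) as [e|u0]; [exfalso; apply xnw; unfold w; now rewrite e|].
    destruct (Req_dec u 1) as [e|u1]; [exfalso; apply ynw; unfold w; now rewrite e|].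
    lra. }
  assert (sw : s w) by (apply fs; auto).
  exists w; repeat split; auto.
  assert (E : q x y * q o w = q x o * q y w + q x w * q o y)
    by (apply (chord_ptolemy_eq s f g); auto; now apply opp).
  assert (A : D o x y = D o x w + D o w y); [|lra].
  apply (inversion_additive q Q o); auto.
  rewrite (sym w o), (sym w y), (sym y o); lra.
Qed.

(** * Circles with three common points *)

Section Uniqueness.
Context (Hc : ext_compact d Om).
Context (H3 : forall x y z : X, exists s, is_circle d Om s /\ s x /\ s y /\ s z).

(** With [o] at infinity, both circles give geodesics from [x] to [y], and the equality puts [p] on
    the one in [s']; [geodesic_unique] identifies them. *)
Lemma arc_unique s s' o x y p : is_circle d Om s -> is_circle d Om s' ->
  s o -> s x -> s y -> s' o -> s' x -> s' y -> s' p ->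
  x <> o -> y <> o -> x <> y -> p <> o -> p <> x -> p <> y ->
  q x y * q p o = q x p * q y o + q x o * q p y -> s p.
Proof.
intros S S' so sx sy so' sx' sy' sp' xo yo xy po px py E.
apply (inversion_additive q Q o) in E; auto; fold (D o) in E.
pose proof (inversion_ptolemaic q Q o) as M; fold (D o) in M.
assert (pos : forall a b, a <> o -> b <> o -> a <> b -> 0 < D o a b).
{ intros a b ha hb n; destruct (Rle_lt_or_eq_dec 0 (D o a b)) as [h|h]; [now apply M|easy|].
  exfalso; apply n, (pt_eq0 _ _ M); auto. }
assert (choose : forall r, is_circle d Om r -> r o -> r x -> r y ->
  exists w : R -> X, forall t, 0 < t < D o x y -> arc_point r o x y t (w t)).
{ intros r Sr ro rx ry.
  assert (ex : forall t, exists w, 0 < t < D o x y -> arc_point r o x y t w).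
  { intros t; destruct (classic (0 < t < D o x y)) as [h|h]; [|now exists x].
    destruct (arc_exists r o x y t) as [w hw]; auto; now exists w. }
  exists (fun t => proj1_sig (constructive_indefinite_description _ (ex t))).
  intros t; exact (proj2_sig (constructive_indefinite_description _ (ex t))). }
destruct (choose s S so sx sy) as [w hw], (choose s' S' so' sx' sy') as [v hv].
assert (ht : 0 < D o x p < D o x y).
{ pose proof (pos x p xo po (not_eq_sym px)); pose proof (pos p y po yo py); lra. }
assert (vp : v (D o x p) = p).
{ assert (a : arc_point s' o x y (D o x p) p) by (repeat split; auto; lra).
  pose proof (arc_dist s' o x y _ _ _ _ S' so' sx' sy' xo yo xy ht ht (hv _ ht) a) as e.
  apply (pt_eq0 _ _ M); [apply (hv _ ht)|easy|].
  rewrite e, Rminus_diag; apply Rabs_R0. }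
rewrite <- vp; replace (v (D o x p)) with (w (D o x p)); [apply (hw _ ht)|].
apply (geodesic_unique (fun a => a <> o) (D o) M) with (x := x) (y := y) (L := D o x y); auto.
- intros a b c ha hb hc; now apply inversion_triangle.
(* A midpoint of [a] and [b] lies halfway along the arc of a circle through [a], [b] and [o]. *)
- intros a b ha hb ab; destruct (H3 a b o) as [r (Sr & ra & rb & ro)].
  specialize (pos a b ha hb ab).
  destruct (arc_exists r o a b (D o a b / 2)) as [m (rm & mo & am & mb)]; auto; [lra|].
  exists m; repeat split; auto; lra.
- intros; now apply (bounded_inversion_clusters d Om Hd Hc Hp o x xo _ r).
- intros t h; destruct (hw t h) as (_ & h1 & h2 & h3); auto.
- intros t h; destruct (hv t h) as (_ & h1 & h2 & h3); auto.
- intros a b ha hb; now apply (arc_dist s o x y a b); auto.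
- intros a b ha hb; now apply (arc_dist s' o x y a b); auto.
Qed.

(** By [circle_four], [p] is paired with one of [x], [y], [z] across the chord of the other two.
    Sending that point to infinity puts [p] on the geodesic arc between the other two. *)
Lemma circle_incl s s' x y z p : is_circle d Om s -> is_circle d Om s' ->
  s x -> s y -> s z -> s' x -> s' y -> s' z ->
  x <> y -> y <> z -> x <> z -> s' p -> s p.
Proof.
intros S S' sx sy sz sx' sy' sz' xy yz xz sp'.
destruct (classic (p = x)) as [->|px]; [easy|].
destruct (classic (p = y)) as [->|py]; [easy|].
destruct (classic (p = z)) as [->|pz]; [easy|].
assert (sym : forall a b, q a b = q b a) by (intros; now apply (dfac_sym d Om Hd)).
destruct (circle_four s' x y z p) as [F|[F|F]]; auto.
- apply (arc_unique s s' y x z p); auto.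
  rewrite (sym p y), (sym z y), (sym p z); lra.
- apply (arc_unique s s' z x y p); auto.
  rewrite (sym p z), (sym p y); lra.
- apply (arc_unique s s' x y z p); auto.
  rewrite (sym p x), (sym z x), (sym y x), (sym p z); lra.
Qed.
End Uniqueness.
End Circles.

Theorem theorem2p4 (X : Type) (d : X -> X -> Rbar) (Om : X -> Prop)
  (Hd : ext_metric d Om) (Hc : ext_compact d Om) (Hp : ptolemy d Om)
  (H3 : forall x y z : X, exists s, is_circle d Om s /\ s x /\ s y /\ s z) :
  forall x y z : X, x <> y -> y <> z -> x <> z ->
    exists s, is_circle d Om s /\ s x /\ s y /\ s z /\
      forall s', is_circle d Om s' -> s' x -> s' y -> s' z ->
        forall p, s' p <-> s p.
Proof.
intros x y z xy yz xz; destruct (H3 x y z) as [s (S & sx & sy & sz)].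
exists s; repeat (split; [easy|]).
intros s' S' sx' sy' sz' p; split.
- now apply (circle_incl d Om Hd Hp Hc H3 s s' x y z).
- now apply (circle_incl d Om Hd Hp Hc H3 s' s x y z).
Qed.
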